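(* Let $A$ be a Noetherian local ring with maximal ideal $\mathfrak{m}$ and $d = \dim A \geq 0$. Let $Q$ be a parameter ideal in $A$ and put $I = Q : \mathfrak{m}$. Suppose that $\mathrm{e}(A) > 1$. Then $I \subseteq Q^{\sharp}$ and $\mathfrak{m}I^n = \mathfrak{m}Q^n$ for all $n \in \mathbb{Z}$.
   Context: A parameter ideal in $A$ is an ideal generated by a system of parameters of $A$ (the zero ideal if $d=0$). $\mathrm{e}(A) = \mathrm{e}^0_{\mathfrak{m}}(A)$ is the multiplicity of $A$ with respect to $\mathfrak{m}$. For an ideal $\mathfrak{a}$ of $A$, $\mathfrak{a}^{\sharp}$ is the integral closure of $\mathfrak{a}$ in $A$. Here $Q:\mathfrak{m} = \{x\in A \mid x\mathfrak{m}\subseteq Q\}$. Powers of ideals with exponent $n \leq 0$ are understood to be $A$. *)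

(* Defs.v *)
From mathcomp Require Import all_boot all_order all_algebra.
From mathcomp Require Import boolp classical_sets.

Set Implicit Arguments.
Unset Strict Implicit.
Unset Printing Implicit Defensive.

Import GRing.Theory.

Local Open Scope classical_set_scope.
Local Open Scope ring_scope.

(* Ideals are Prop-valued sets and may be improper: [idealr_closed] of
   ring_quotient excludes the unit ideal, which is needed here (it is the
   zeroth power of every ideal). *)
Section Ideals.
Variable A : comNzRingType.
Implicit Types (I J P Q M m X : set A).

Definition is_ideal I : Prop :=
  [/\ I 0, (forall x y, I x -> I y -> I (x + y))
    & (forall a x, I x -> I (a * x))].

Definition ideal_gen X : set A := smallest is_ideal X.

Definition ideal_mul I J : set A :=
  ideal_gen [set z | exists x y, [/\ I x, J y & z = x * y]].

Definition ideal_exp I (n : nat) : set A := iter n (ideal_mul I) setT.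

(* A negative power is the whole ring. *)
Definition ideal_expz I (n : int) : set A :=
  match n with Posz k => ideal_exp I k | Negz _ => setT end.

Definition colon I J : set A := [set x | forall y, J y -> I (x * y)].

Definition ideal_radical I : set A := [set x | exists n, I (x ^+ n)].

(* x with x^n + c_1 x^(n-1) + ... + c_n = 0 for some n > 0 and c_i in I^i. *)
Definition integral_closure I : set A :=
  [set x | exists (n : nat) (c : nat -> A),
     [/\ (0 < n)%N,
         forall i, (0 < i <= n)%N -> ideal_exp I i (c i)
       & x ^+ n + \sum_(1 <= i < n.+1) c i * x ^+ (n - i) = 0]].

Definition prime_ideal P : Prop :=
  [/\ is_ideal P, ~ P 1 & forall x y, P (x * y) -> P x \/ P y].

Definition primary_ideal Q : Prop :=
  [/\ is_ideal Q, ~ Q 1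
    & forall x y, Q (x * y) -> Q x \/ ideal_radical Q y].

Definition maximal_ideal M : Prop :=
  [/\ is_ideal M, ~ M 1
    & forall J, is_ideal J -> M `<=` J -> J = M \/ J = setT].

Definition noetherian : Prop :=
  forall I, is_ideal I ->
    exists (n : nat) (a : 'I_n -> A), I = ideal_gen (range a).

Definition local_with_maximal_ideal m : Prop :=
  maximal_ideal m /\ forall M, maximal_ideal M -> M = m.

(* P_0 < P_1 < ... < P_n; values beyond the index n are irrelevant. *)
Definition prime_chain (P : nat -> set A) (n : nat) : Prop :=
  (forall i, (i <= n)%N -> prime_ideal (P i)) /\
  (forall i, (i < n)%N -> P i `<` P i.+1).

Definition has_krull_dim (d : nat) : Prop :=
  (exists P : nat -> set A, prime_chain P d) /\
  (forall (P : nat -> set A) n, prime_chain P n -> (n <= d)%N).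

(* The submodules of A/I correspond to the ideals containing I, so this is a
   strict chain of length l of submodules of A/I running from 0 to A/I. *)
Definition quotient_chain I (J : nat -> set A) (l : nat) : Prop :=
  [/\ forall i, (i <= l)%N -> is_ideal (J i),
      forall i, (i < l)%N -> J i `<` J i.+1,
      J 0%N = I & J l = setT].

(* The A-module A/I has finite length l. *)
Definition has_quotient_length I (l : nat) : Prop :=
  (exists J : nat -> set A, quotient_chain I J l) /\
  (forall (J : nat -> set A) k, quotient_chain I J k -> (k <= l)%N).

(* The empty family is allowed: for d = 0 the ideal generated is 0. *)
Definition system_of_parameters m (d : nat) (a : 'I_d -> A) : Prop :=
  [/\ has_krull_dim d, primary_ideal (ideal_gen (range a))
    & ideal_radical (ideal_gen (range a)) = m].

Definition parameter_ideal m Q : Prop :=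
  exists (d : nat) (a : 'I_d -> A),
    system_of_parameters m a /\ Q = ideal_gen (range a).

(* c_0, ..., c_d are the Hilbert coefficients of I in A, d = dim A:
   for all n >> 0, the length of A/I^(n+1) is
   c_0 C(n+d, d) - c_1 C(n+d-1, d-1) + ... + (-1)^d c_d. *)
Definition hilbert_coefficients I (d : nat) (c : 'I_d.+1 -> int) : Prop :=
  has_krull_dim d /\
  exists N : nat, forall n, (N <= n)%N ->
    exists l : nat, has_quotient_length (ideal_exp I n.+1) l /\
      l%:Z = \sum_(i < d.+1) (-1) ^+ i * c i * ('C(n + d - i, d - i))%:Z.

(* The multiplicity of A with respect to I is the leading coefficient c_0. *)
Definition has_multiplicity I (e : int) : Prop :=
  exists (d : nat) (c : 'I_d.+1 -> int),
    hilbert_coefficients I c /\ c ord0 = e.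

End Ideals.

Arguments noetherian A : clear implicits.
Arguments has_krull_dim A d : clear implicits.

(* Main.v *)
Require Import Defs.
From mathcomp Require Import all_boot all_order all_algebra.
From mathcomp Require Import boolp classical_sets.
From mathcomp Require Import ring zify.

(** If some product [xy] with [x] in [m] and [y] in [I] lies outside [mQ], it is
    part of a minimal system of generators of [Q], say [Q = (xy) + K] with [K]
    generated by [d - 1] elements. As [my] lies in [Q], this gives
    [m = (x) + (K : y)]; modulo [K] the ideal [K : y] has finite length, so the
    length of [A/(K + m^(n+1))] is at most [n + 1 + L]. Each generator of [K]
    raises the degree of the bound by one, so the length of [A/m^(n+1)] is at
    most [C(n+d, d) + L C(n+d-1, d-1)], against [e(A) > 1]. Hence [mI = mQ],
    which gives the equality for all powers, and integrality over [Q] by the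
    determinant trick applied to [m]. *)

Import Order.TTheory GRing.Theory Num.Theory.

Local Open Scope classical_set_scope.
Local Open Scope ring_scope.

Set Implicit Arguments.
Unset Strict Implicit.
Unset Printing Implicit Defensive.

(** * Ideals *)

Section IdealArithmetic.
Variable A : comNzRingType.
Implicit Types (I J K P Q X : set A) (x y z a : A) (s t : seq A).

Lemma is_ideal0 I : is_ideal I -> I 0. Proof. by case. Qed.

Lemma is_idealD I x y : is_ideal I -> I x -> I y -> I (x + y).
Proof. by case=> _ h _; apply: h. Qed.

Lemma is_idealM I a x : is_ideal I -> I x -> I (a * x).
Proof. by case=> _ _ h; apply: h. Qed.

Lemma is_idealMr I a x : is_ideal I -> I x -> I (x * a).
Proof. by rewrite mulrC; apply: is_idealM. Qed.

Lemma is_idealB I x y : is_ideal I -> I x -> I y -> I (x - y).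
Proof. by move=> hI Ix Iy; rewrite -mulN1r; apply: is_idealD => //; apply: is_idealM. Qed.

Lemma is_ideal_sum (T : Type) (r : seq T) (p : pred T) (F : T -> A) I :
  is_ideal I -> (forall i, p i -> I (F i)) -> I (\sum_(i <- r | p i) F i).
Proof.
move=> hI hF; elim/big_ind: _ => //; first exact: is_ideal0.
by move=> x y; apply: is_idealD.
Qed.

Lemma is_idealT : is_ideal [set: A]. Proof. by []. Qed.

Lemma ideal_eqT I : is_ideal I -> I 1 -> I = setT.
Proof. by move=> hI I1; rewrite -subTset => x _; rewrite -(mulr1 x); apply: is_idealM. Qed.

Lemma is_ideal_gen X : is_ideal (ideal_gen X).
Proof.
split.
- by move=> J [[]].
- by move=> x y hx hy J [hJ XJ]; apply: is_idealD; [|apply: hx|apply: hy].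
- by move=> a x hx J [hJ XJ]; apply: is_idealM; [|apply: hx].
Qed.

Lemma sub_ideal_gen X : X `<=` ideal_gen X.
Proof. exact: sub_smallest. Qed.

Lemma ideal_gen_sub X J : is_ideal J -> X `<=` J -> ideal_gen X `<=` J.
Proof. by move=> hJ XJ x; apply. Qed.

Lemma is_ideal_mul I J : is_ideal (ideal_mul I J).
Proof. exact: is_ideal_gen. Qed.

Lemma mem_ideal_mul I J x y : I x -> J y -> ideal_mul I J (x * y).
Proof. by move=> Ix Jy; apply: sub_ideal_gen; exists x, y. Qed.

Lemma ideal_mul_sub I J K : is_ideal K ->
  (forall x y, I x -> J y -> K (x * y)) -> ideal_mul I J `<=` K.
Proof. by move=> hK h; apply: ideal_gen_sub => // z [x [y [Ix Jy ->]]]; apply: h. Qed.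

Lemma ideal_mulSS I I' J J' : I `<=` I' -> J `<=` J' ->
  ideal_mul I J `<=` ideal_mul I' J'.
Proof.
move=> hI hJ; apply: ideal_mul_sub; first exact: is_ideal_mul.
by move=> x y /hI Ix /hJ Jy; apply: mem_ideal_mul.
Qed.

Lemma ideal_mulC I J : ideal_mul I J = ideal_mul J I.
Proof.
by apply/seteqP; split; apply: ideal_mul_sub => [|x y Ix Jy];
  [exact: is_ideal_mul | rewrite mulrC; exact: mem_ideal_mul
  |exact: is_ideal_mul | rewrite mulrC; exact: mem_ideal_mul].
Qed.

Lemma is_ideal_colon I J : is_ideal I -> is_ideal (colon I J).
Proof.
move=> hI; split=> [y _|x x' hx hx' y Jy|a x hx y Jy].
- by rewrite mul0r; apply: is_ideal0.
- by rewrite mulrDl; apply: is_idealD; [|apply: hx|apply: hx'].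
- by rewrite -mulrA; apply: is_idealM; [|apply: hx].
Qed.

(** The colon ideal by [[set x]] collects the [w] with [w * x] in the target, so the inner product,
    too, need only be tested on its generators. *)
Lemma ideal_mul_subA I J K :
  ideal_mul I (ideal_mul J K) `<=` ideal_mul (ideal_mul I J) K.
Proof.
apply: ideal_mul_sub; first exact: is_ideal_mul.
move=> x w Ix; rewrite mulrC; move: w.
suff: ideal_mul J K `<=` colon (ideal_mul (ideal_mul I J) K) [set x].
  by move=> h w /h; apply.
apply: ideal_mul_sub; first exact/is_ideal_colon/is_ideal_mul.
move=> y z Jy Kz _ ->; rewrite mulrC mulrA.
by apply: mem_ideal_mul => //; apply: mem_ideal_mul.
Qed.

Lemma ideal_mulA I J K :
  ideal_mul I (ideal_mul J K) = ideal_mul (ideal_mul I J) K.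
Proof.
apply/seteqP; split; first exact: ideal_mul_subA.
rewrite (ideal_mulC (ideal_mul I J)) (ideal_mulC I J).
rewrite (ideal_mulC I (ideal_mul J K)) (ideal_mulC J K).
exact: ideal_mul_subA.
Qed.

Lemma ideal_mulCA I J K :
  ideal_mul I (ideal_mul J K) = ideal_mul J (ideal_mul I K).
Proof. by rewrite !ideal_mulA (ideal_mulC I). Qed.

Lemma ideal_mulT I : is_ideal I -> ideal_mul I setT = I.
Proof.
move=> hI; apply/seteqP; split.
  by apply: ideal_mul_sub => // x y Ix _; apply: is_idealMr.
by move=> x Ix; rewrite -(mulr1 x); apply: mem_ideal_mul.
Qed.

Lemma is_ideal_exp I n : is_ideal (ideal_exp I n).
Proof. by case: n => [|n]; [exact: is_idealT|exact: is_ideal_mul]. Qed.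

Lemma ideal_expS_sub I n : ideal_exp I n.+1 `<=` ideal_exp I n.
Proof.
apply: ideal_mul_sub; first exact: is_ideal_exp.
by move=> x y _; apply: is_idealM; exact: is_ideal_exp.
Qed.

Lemma ideal_exp_sub I n k : (k <= n)%N -> ideal_exp I n `<=` ideal_exp I k.
Proof.
move=> /subnK <-; elim: (n - k)%N => [|l IH] //.
by rewrite addSn => x /ideal_expS_sub /IH.
Qed.

Lemma ideal_expD I n k x y :
  ideal_exp I n x -> ideal_exp I k y -> ideal_exp I (n + k) (x * y).
Proof.
move=> hx hy; move: x hx; elim: n => [x _|n IH].
  by apply: is_idealM; first exact: is_ideal_exp.
suff: ideal_exp I n.+1 `<=` colon (ideal_exp I (n.+1 + k)) [set y].
  by move=> h x /h; apply.
apply: ideal_mul_sub; first exact/is_ideal_colon/is_ideal_exp.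
move=> u v Iu hv _ ->; rewrite -mulrA addSn.
by apply: mem_ideal_mul => //; apply: IH.
Qed.

Lemma ideal_exp_expr I n x : I x -> ideal_exp I n (x ^+ n).
Proof.
by move=> Ix; elim: n => [|n IH] //; rewrite exprS; apply: mem_ideal_mul.
Qed.

(** * Sums of ideals and principal ideals *)

Definition ideal_add I J : set A :=
  [set z | exists x y, [/\ I x, J y & z = x + y]].

Definition principal x : set A := [set z | exists c, z = c * x].

Lemma is_ideal_principal x : is_ideal (principal x).
Proof.
split=> [|_ _ [c ->] [d ->]|a _ [c ->]]; first by exists 0; rewrite mul0r.
  by exists (c + d); rewrite mulrDl.
by exists (a * c); rewrite mulrA.
Qed.

Lemma mem_principal x : principal x x. Proof. by exists 1; rewrite mul1r. Qed.

Lemma principal_sub x I : is_ideal I -> I x -> principal x `<=` I.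
Proof. by move=> hI Ix _ [c ->]; apply: is_idealM. Qed.

Lemma is_ideal_add I J : is_ideal I -> is_ideal J -> is_ideal (ideal_add I J).
Proof.
move=> hI hJ; split.
- by exists 0, 0; split; rewrite ?addr0 //; apply: is_ideal0.
- move=> _ _ [x [y [Ix Jy ->]]] [x' [y' [Ix' Jy' ->]]].
  by exists (x + x'), (y + y'); split; [exact: is_idealD|exact: is_idealD|ring].
- move=> a _ [x [y [Ix Jy ->]]].
  by exists (a * x), (a * y); split; [exact: is_idealM|exact: is_idealM|ring].
Qed.

Lemma sub_ideal_addl I J : is_ideal J -> I `<=` ideal_add I J.
Proof. by move=> hJ x Ix; exists x, 0; split; rewrite ?addr0 //; apply: is_ideal0. Qed.

Lemma sub_ideal_addr I J : is_ideal I -> J `<=` ideal_add I J.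
Proof. by move=> hI x Ix; exists 0, x; split; rewrite ?add0r //; apply: is_ideal0. Qed.

Lemma ideal_add_sub I J K : is_ideal K -> I `<=` K -> J `<=` K ->
  ideal_add I J `<=` K.
Proof. by move=> hK IK JK _ [x [y [/IK ? /JK ? ->]]]; apply: is_idealD. Qed.

Lemma ideal_addC I J : ideal_add I J = ideal_add J I.
Proof.
by apply/seteqP; split=> _ [x [y [? ? ->]]]; exists y, x; rewrite addrC.
Qed.

Lemma ideal_addA I J K :
  ideal_add I (ideal_add J K) = ideal_add (ideal_add I J) K.
Proof.
apply/seteqP; split.
  move=> _ [x [_ [Ix [y [z [Jy Kz ->]]] ->]]].
  by exists (x + y), z; split => //; [exists x, y|rewrite addrA].
move=> _ [_ [z [[x [y [Ix Jy ->]]] Kz ->]]].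
by exists x, (y + z); split => //; [exists y, z|rewrite addrA].
Qed.

Lemma ideal_addAC I J K :
  ideal_add (ideal_add I J) K = ideal_add (ideal_add I K) J.
Proof. by rewrite -!ideal_addA (ideal_addC J). Qed.

Lemma ideal_add_idr I J : is_ideal I -> is_ideal J -> J `<=` I -> ideal_add I J = I.
Proof.
move=> hI hJ JI; apply/seteqP; split; first exact: ideal_add_sub.
exact: sub_ideal_addl.
Qed.

Definition ideal_span s : set A := foldr (fun a => ideal_add (principal a)) [set 0] s.

Lemma is_ideal_set0 : is_ideal [set (0 : A)].
Proof. by split=> [|x y /= -> ->|a x /= ->]; rewrite ?addr0 ?mulr0. Qed.

Lemma is_ideal_span s : is_ideal (ideal_span s).
Proof.
elim: s => [|a s IH]; first exact: is_ideal_set0.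
exact: is_ideal_add (is_ideal_principal a) IH.
Qed.

Lemma mem_ideal_span s a : a \in s -> ideal_span s a.
Proof.
elim: s => [//|b s IH]; rewrite inE => /predU1P[->|/IH ha] /=.
  by apply: sub_ideal_addl (mem_principal _); exact: is_ideal_span.
by apply: sub_ideal_addr ha; exact: is_ideal_principal.
Qed.

Lemma ideal_span_sub s I : is_ideal I -> (forall a, a \in s -> I a) -> ideal_span s `<=` I.
Proof.
move=> hI; elim: s => [_ _ -> |a s IH h]; first exact: is_ideal0.
apply: ideal_add_sub => //; first by apply: principal_sub => //; exact/h/mem_head.
by apply: IH => b bs; apply: h; rewrite inE bs orbT.
Qed.

Lemma ideal_gen_rangeE n (a : 'I_n -> A) : ideal_gen (range a) = ideal_span (codom a).
Proof.
apply/seteqP; split.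
  apply: ideal_gen_sub; first exact: is_ideal_span.
  by move=> _ [i _ <-]; exact/mem_ideal_span/codom_f.
apply: ideal_span_sub; first exact: is_ideal_gen.
by move=> _ /codomP[i ->]; apply: sub_ideal_gen; exists i.
Qed.

(** The combinations of the [a i] with coefficients in an ideal [P] form an ideal [L P]. All
    generators lie in [L setT], and a factor from [Q] moves the coefficients into [Q]. *)
Lemma ideal_mul_gen_range n (a : 'I_n -> A) Q z : is_ideal Q ->
  ideal_mul Q (ideal_gen (range a)) z ->
  exists2 q : 'I_n -> A, forall i, Q (q i) & z = \sum_i q i * a i.
Proof.
move=> hQ.
pose L P := [set z | exists2 q : 'I_n -> A, forall i, P (q i) & z = \sum_i q i * a i].
have idL P : is_ideal P -> is_ideal (L P).
  move=> hP; split.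
  - exists (fun=> 0); first by move=> _; apply: is_ideal0.
    by rewrite big1 // => i _; rewrite mul0r.
  - move=> _ _ [q hq ->] [q' hq' ->]; exists (fun i => q i + q' i).
      by move=> i; apply: is_idealD.
    by rewrite -big_split; apply: eq_bigr => i _; rewrite mulrDl.
  - move=> b _ [q hq ->]; exists (fun i => b * q i).
      by move=> i; apply: is_idealM.
    by rewrite mulr_sumr; apply: eq_bigr => i _; rewrite mulrA.
have genL : ideal_gen (range a) `<=` L setT.
  apply: ideal_gen_sub; first exact/idL/is_idealT.
  move=> _ [i _ <-]; exists (fun j => (j == i)%:R) => //.
  rewrite (bigD1 i) //= eqxx mul1r big1 ?addr0 // => j /negPf ->.
  by rewrite mul0r.
suff h : ideal_mul Q (ideal_gen (range a)) `<=` L Q by exact: h.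
apply: ideal_mul_sub => [|x y Qx /genL[c _ ->]]; first exact: idL.
exists (fun i => x * c i); first by move=> i; apply: is_idealMr.
by rewrite mulr_sumr; apply: eq_bigr => i _; rewrite mulrA.
Qed.

End IdealArithmetic.

(** * Length bounds by filtrations *)

Section Filtrations.
Variable A : comNzRingType.
Implicit Types (I J K P Q X m D E : set A) (x y z a : A) (s t : seq A).

(* A chain of ideals from [I] to [J] of length [l] whose successive quotients
   are zero or copies of [A/m]; it bounds the length of [J/I] from above. *)
Inductive filtered m I : set A -> nat -> Prop :=
| filtered0 : filtered m I I 0
| filteredS J x l : filtered m I J l -> (forall z, m z -> J (z * x)) ->
    filtered m I (ideal_add J (principal x)) l.+1.

Lemma is_ideal_filtered m I J l : is_ideal I -> filtered m I J l -> is_ideal J.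
Proof.
move=> hI; elim=> // K x k _ hK _.
exact: is_ideal_add hK (is_ideal_principal x).
Qed.

Lemma filtered_sub m I J l : is_ideal I -> filtered m I J l -> I `<=` J.
Proof.
move=> hI; elim=> // K x k _ IK _ y /IK Ky.
by apply: sub_ideal_addl Ky; exact: is_ideal_principal.
Qed.

Lemma filtered_trans m I J K k l :
  filtered m I J k -> filtered m J K l -> filtered m I K (k + l).
Proof.
move=> hIJ; elim=> [|L x n _ IH h]; first by rewrite addn0.
by rewrite addnS; apply: filteredS.
Qed.

(* Multiplication by [a] followed by projection maps [E/D] onto
   [(K + aE)/K]. *)
Lemma filtered_mul m D E K a l : is_ideal D -> is_ideal K ->
  (forall x, D x -> K (a * x)) -> filtered m D E l ->
  filtered m K (ideal_add K [set z | exists2 x, E x & z = a * x]) l.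
Proof.
move=> hD hK aD; elim=> [|F x n hF IH hx].
  rewrite (_ : ideal_add _ _ = K); first exact: filtered0.
  apply/seteqP; split.
    by move=> _ [u [_ [Ku [v /aD Kv ->] ->]]]; apply: is_idealD.
  move=> u Ku; exists u, 0; split; rewrite ?addr0 //.
  by exists 0; rewrite ?mulr0 //; apply: is_ideal0.
rewrite (_ : ideal_add K _ =
  ideal_add (ideal_add K [set z | exists2 x, F x & z = a * x]) (principal (a * x))).
  apply: filteredS => // z /hx Fzx; exists 0, (a * (z * x)).
  by split; [exact: is_ideal0|exists (z * x)|ring].
rewrite -ideal_addA; congr ideal_add; apply/seteqP; split.
  move=> _ [_ [u [_ [Fu [c ->] ->]]] ->].
  by exists (a * u), (c * (a * x)); split; [exists u|exists c|ring].
move=> _ [_ [_ [[u Fu ->] [c ->] ->]]].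
by exists (u + c * x); [exists u, (c * x); split => //; exists c|ring].
Qed.

Lemma filtered_principal m D K a l : is_ideal D -> is_ideal K ->
  (forall x, D x -> K (a * x)) -> filtered m D setT l ->
  filtered m K (ideal_add K (principal a)) l.
Proof.
move=> hD hK aD hf.
rewrite (_ : principal a = [set z | exists2 x, setT x & z = a * x]).
  exact: filtered_mul hf.
apply/seteqP; split=> [_ [c ->]|_ [c _ ->]].
  by exists c => //; rewrite mulrC.
by exists c; rewrite mulrC.
Qed.

(** Adding [K] may turn a successive quotient into zero; [filtered] allows this, so the length stays
    [l]. *)
Lemma filtered_add m I J K l : is_ideal K -> filtered m I J l ->
  filtered m (ideal_add I K) (ideal_add J K) l.
Proof.
move=> hK; elim=> [|F x n _ IH hx]; first exact: filtered0.
rewrite ideal_addAC; apply: filteredS => // z /hx.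
exact: sub_ideal_addl.
Qed.

Lemma filtered_setT m D E l : is_ideal E -> D `<=` E -> is_ideal D ->
  filtered m D setT l -> filtered m E setT l.
Proof.
move=> hE DE hD /(filtered_add hE).
by rewrite (ideal_addC D) !ideal_add_idr // ideal_addC ideal_add_idr.
Qed.

Lemma filtered_maximal m : is_ideal m -> filtered m m setT 1.
Proof.
move=> hm.
have -> : [set: A] = ideal_add m (principal 1).
  symmetry; apply: ideal_eqT.
    exact: is_ideal_add hm (is_ideal_principal 1).
  by apply: sub_ideal_addr; [|exact: mem_principal].
by apply: filteredS => [|z mz]; [exact: filtered0|rewrite mulr1].
Qed.

(** Multiplication by each [a] in [s] maps [A/D] onto [(K + aA)/K], so every generator adds [l]
    steps. *)
Lemma filtered_span m D K s l : is_ideal D -> is_ideal K ->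
  (forall a, a \in s -> forall x, D x -> K (a * x)) -> filtered m D setT l ->
  exists k, filtered m K (ideal_add K (ideal_span s)) k.
Proof.
move=> hD hK + hf; elim: s => [_|a s IH h].
  exists 0; rewrite ideal_add_idr //; [exact: filtered0|exact: is_ideal_set0|].
  by move=> _ ->; apply: is_ideal0.
have [|k hk] := IH; first by move=> b bs; apply: h; rewrite inE bs orbT.
exists (l + k)%N; apply: (@filtered_trans _ _ (ideal_add K (principal a))).
  by apply: filtered_principal hf => //; exact/h/mem_head.
rewrite /= ideal_addA ideal_addAC.
exact: filtered_add (is_ideal_principal a) hk.
Qed.

(** Modulo [a] one generator fewer remains, so [A/(D + aA)] is filtered by induction. The ideals
    [D + a^k A] then interpolate between [A] and [D], and multiplication by [a^k] maps [A/(D + aA)]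
    onto each layer. *)
Lemma filtered_radical m D s : is_ideal m -> is_ideal D ->
  m `<=` ideal_add D (ideal_span s) -> (forall a, a \in s -> ideal_radical D a) ->
  exists l, filtered m D setT l.
Proof.
move=> hm; elim: s D => [|a s IH] D hD mD radD.
  exists 1; apply: filtered_setT (filtered_maximal hm) => //.
  by move=> x /mD [u [_ [Du -> ->]]]; rewrite addr0.
have hDa n : is_ideal (ideal_add D (principal (a ^+ n))).
  exact: is_ideal_add hD (is_ideal_principal _).
have [l hl] : exists l, filtered m (ideal_add D (principal a)) setT l.
  apply: IH; first exact: (hDa 1).
    by move=> x /mD; rewrite /= ideal_addA.
  move=> b bs; have [|n Dn] := radD b; first by rewrite inE bs orbT.
  by exists n; apply: sub_ideal_addl Dn; exact: is_ideal_principal.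
have [n Dn] := radD a (mem_head _ _).
(* At [k = 0] this ideal is [A]; at the [n] with [a ^+ n] in [D] it is [D]. *)
suff h k : exists l, filtered m (ideal_add D (principal (a ^+ k))) setT l.
  have <- : ideal_add D (principal (a ^+ n)) = D; last exact: h.
  by apply: ideal_add_idr => //; [exact: is_ideal_principal|exact: principal_sub].
elim: k => [|k [l' hl']].
  exists 0; rewrite (ideal_eqT (hDa 0)); first exact: filtered0.
  by apply: sub_ideal_addr; [|exact: mem_principal].
exists (l + l')%N; apply: filtered_trans hl'.
have -> : ideal_add D (principal (a ^+ k)) =
   ideal_add (ideal_add D (principal (a ^+ k.+1))) (principal (a ^+ k)).
  rewrite ideal_addAC [RHS]ideal_add_idr //; first exact: is_ideal_principal.
  apply: principal_sub => //; exists 0, (a ^+ k.+1); split.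
  - exact: is_ideal0.
  - by exists a; rewrite exprS.
  - by rewrite add0r.
apply: filtered_principal hl => // [|_ [u [_ [Du [c ->] ->]]]]; first exact: (hDa 1).
exists (a ^+ k * u), (c * a ^+ k.+1); split; last by rewrite exprS; ring.
  exact: is_idealM.
by exists c.
Qed.

(* Over [F], an ideal of [F + xA] not inside [F] surjects onto [(F + xA)/F],
   so two such ideals are compared by their intersections with [F]. *)
Lemma sub_of_sub_inter m F x K L :
  (forall c, ~ m c -> exists c', c' * c = 1) -> is_ideal F ->
  (forall z, m z -> F (z * x)) -> is_ideal K -> is_ideal L ->
  K `<=` ideal_add F (principal x) -> ~ (K `<=` F) ->
  K `<=` L -> L `<=` ideal_add F (principal x) -> L `&` F `<=` K -> L `<=` K.
Proof.
move=> unit_m hF hx hK hL KJ KF KL LJ LFK z Lz.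
have [u Ku Fu] : exists2 u, K u & ~ F u.
  apply: contrapT => h; apply: KF => u Ku.
  by apply: contrapT => Fu; apply: h; exists u.
have [f [_ [Ff [c ->] uE]]] := KJ _ Ku.
have [|c' cc'] := unit_m c.
  by move=> /hx hcx; apply: Fu; rewrite uE; apply: is_idealD.
have [g [_ [Fg [b ->] zE]]] := LJ _ Lz.
have xE : x = c' * (u - f) by rewrite uE addrC addKr mulrA cc' mul1r.
have -> : z = (z - b * c' * u) + b * c' * u by ring.
apply: is_idealD => //; last exact: is_idealM.
apply: LFK; split; first by apply: is_idealB => //; apply: is_idealM => //; exact: KL.
have -> : z - b * c' * u = g - b * c' * f by rewrite zE {1}xE; ring.
by apply: is_idealB => //; apply: is_idealM.
Qed.

(** Induction on the filtration: a chain in [F + xA] yields a chain in [F] with only one inclusion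
    fewer, because [(F + xA)/F] is zero or simple. *)
Lemma filtered_chain m I J l (C : nat -> set A) k :
  (forall c, ~ m c -> exists c', c' * c = 1) -> is_ideal I ->
  filtered m I J l ->
  (forall i, (i <= k)%N -> [/\ is_ideal (C i), I `<=` C i & C i `<=` J]) ->
  (forall i, (i < k)%N -> C i `<` C i.+1) -> (k <= l)%N.
Proof.
move=> unit_m hI hf; elim: hf C k => [|F x n hF IH hx] C k hC CS.
  case: k hC CS => // k hC CS; have [_ _ h1] := hC 1 isT.
  have [_ h0 _] := hC 0 isT; have [_ []] := CS 0 isT.
  exact: subset_trans h1 h0.
case: k hC CS => // k hC CS; rewrite ltnS.
have idF := is_ideal_filtered hI hF.
have IF := filtered_sub hI hF.
(* Once [C i] leaves [F] the index is shifted by one, which skips the only inclusion that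
   intersecting with [F] may collapse. *)
pose D i := if asbool (C i `<=` F) then C i else C i.+1 `&` F.
apply: (IH D) => i ik; rewrite /D.
  have [idC IC CJ] := hC i (leqW ik); have [idC' IC' CJ'] := hC i.+1 ik.
  case: asboolP => [h|_]; split=> //.
  - split; first by split; apply: is_ideal0.
      by move=> u v [? ?] [? ?]; split; apply: is_idealD.
    by move=> u v [? ?]; split; apply: is_idealM.
  - by move=> u Iu; split; [exact: IC'|exact: IF].
have [idC IC CJ] := hC i (leqW (ltnW ik)).
have [idC' IC' CJ'] := hC i.+1 (leqW ik).
have [idC'' IC'' CJ''] := hC i.+2 ik.
have [CC1 CC1'] := CS i (leqW ik).
have [CC2 CC2'] := CS i.+1 ik.
have modular : ~ (C i.+1 `<=` F) -> ~ (C i.+2 `&` F `<=` C i.+1).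
  by move=> nF h; apply: CC2'; exact: (sub_of_sub_inter unit_m idF hx idC' idC'' CJ' nF CC2 CJ'' h).
case: asboolP => CF; case: asboolP => CF'.
- by split.
- split; first by move=> u Cu; split; [exact/CC2/CC1|exact: CF].
  by move=> h; apply: modular => // u /h /CC1.
- by case: CF; apply: subset_trans CF'.
- split; first by move=> u [/CC2].
  by move=> h; apply: modular => // u /h [].
Qed.
End Filtrations.

(** * Local rings *)

Section LocalRings.
Variable A : comNzRingType.
Implicit Types (I J K P Q X m D E : set A) (x y z a : A) (s t : seq A).

(** By Zorn's lemma a nonunit [c] lies in an ideal maximal among the proper ideals containing it;
    this is a maximal ideal, hence [m]. *)
Lemma local_unit m c : local_with_maximal_ideal m -> ~ m c ->
  exists c', c' * c = 1.
Proof.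
move=> [_ uniq_m] mc; apply: contrapT => nU.
pose P X := X = set0 \/ [/\ is_ideal X, ~ X 1 & X c].
have [F FP totF|M [PM maxM]] := @Zorn_bigcup A P.
  have [[X FX Xc]|Fc] := pselect (exists2 X, F X & X c); last first.
    left; rewrite -subset0 => x [X FX Xx].
    have [X0|[_ _ Xc]] := FP _ FX; first by rewrite -X0.
    by apply: Fc; exists X.
  have FI Y y : F Y -> Y y -> is_ideal Y.
    by move=> /FP[->|[]].
  right; split; last by exists X.
    split.
    - by exists X => //; apply: is_ideal0; apply: FI Xc.
    - move=> x y [Y FY Yx] [Z FZ Zy]; have [YZ|ZY] := totF _ _ FY FZ.
        by exists Z => //; apply: is_idealD => //; [exact: FI Zy|exact: YZ].
      by exists Y => //; apply: is_idealD => //; [exact: FI Yx|exact: ZY].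
    - by move=> a x [Y FY Yx]; exists Y => //; apply: is_idealM => //; exact: FI Yx.
  move=> [Y FY Y1]; have [Y0|[_ nY1 _]] := FP _ FY; last exact: nY1.
  by rewrite Y0 in Y1.
case: PM => [M0|[idM M1 Mc]].
  apply: (maxM (principal c)); last first.
    right; split; [exact: is_ideal_principal| |exact: mem_principal].
    by move=> [c' cc']; apply: nU; exists c'.
  rewrite M0; split=> // h; apply: (h c); exact: mem_principal.
apply: mc; rewrite -(uniq_m M) //; split=> // J idJ MJ.
have [J1|J1] := pselect (J 1); first by right; apply: ideal_eqT.
left; apply: contrapT => JM; apply: (maxM J); last by right; split=> //; exact: MJ.
by split=> // JM'; apply: JM; apply/seteqP.
Qed.

(** Write [z] as a combination of [s]. Either all coefficients lie in [m], or one of them is a unit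
    and [z] can replace its generator. *)
Lemma ideal_span_exchange m s z :
  (forall c, ~ m c -> exists c', c' * c = 1) -> ideal_span s z ->
  ideal_mul m (ideal_span s) z \/
  exists s', [/\ size s = (size s').+1, {subset s' <= s} &
    ideal_span s = ideal_add (principal z) (ideal_span s')].
Proof.
move=> unit_m; elim: s z => [z ->|a s IH z].
  by left; apply: is_ideal0; exact: is_ideal_mul.
move=> [_ [z' [[c ->] sz' zE]]].
have [mc|/unit_m[c' cc']] := pselect (m c); last first.
  right; exists s; split=> // [b bs|]; first by rewrite inE bs orbT.
  have hs := is_ideal_span s.
  apply/seteqP; split; apply: ideal_add_sub.
  - exact: is_ideal_add (is_ideal_principal z) hs.
  - apply: principal_sub; first exact: is_ideal_add (is_ideal_principal z) hs.
    exists (c' * z), (- c' * z'); split; [by exists c'|exact: is_idealM|].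
    by rewrite zE mulrDr mulrA cc' mul1r mulNr addrK.
  - exact: sub_ideal_addr (is_ideal_principal z).
  - exact: is_ideal_span (a :: s).
  - apply: principal_sub; first exact: is_ideal_span (a :: s).
    by exists (c * a), z'; split => //; exists c.
  - exact: sub_ideal_addr (is_ideal_principal a).
have subs : ideal_span s `<=` ideal_span (a :: s).
  exact: sub_ideal_addr (is_ideal_principal a).
have [mz'|[s' [sz ss' sE]]] := IH _ sz'.
  left; rewrite zE; apply: (@is_idealD _ (ideal_mul m (ideal_span (a :: s)))); first exact: is_ideal_mul.
    by apply: mem_ideal_mul => //; exact/mem_ideal_span/mem_head.
  exact: ideal_mulSS mz'.
right; exists (a :: s'); split; first by rewrite /= sz.
  by move=> b; rewrite !inE => /orP[->//|/ss' ->]; rewrite orbT.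
rewrite /= sE ideal_addA [RHS]ideal_addA; congr ideal_add.
have ida := is_ideal_principal a; have idz := is_ideal_principal z.
have idz' := is_ideal_principal z'.
apply/seteqP; split; apply: ideal_add_sub; try exact: is_ideal_add.
- exact: sub_ideal_addr.
- apply: principal_sub; first exact: is_ideal_add.
  by exists z, (- c * a); split; [exact: mem_principal|exists (-c)|rewrite zE; ring].
- apply: principal_sub; first exact: is_ideal_add.
  by exists (c * a), z'; split; [exists c|exact: mem_principal|].
- exact: sub_ideal_addl.
Qed.

(** The intermediate ideal is [W = K : y]. As [W/K] is a finitely generated module over
    [A/(K + yA)], which has finite length, it contributes a constant [L]. Modulo [W] the ideal [m]
    is generated by [x], so each power of [m] adds at most one. *)
Lemma filtered_almost_principal m K x y : noetherian A ->
  is_ideal m -> is_ideal K -> m x ->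
  m `<=` ideal_radical (ideal_add K (principal (x * y))) ->
  (forall z, m z -> exists c, K ((z - c * x) * y)) ->
  exists L, forall n,
    filtered m (ideal_add K (ideal_exp m n.+1)) setT (n.+1 + L).
Proof.
move=> hN hm hK mx radK hmy.
pose W := colon K [set y].
have hW : is_ideal W by exact: is_ideal_colon.
have KW : K `<=` W by move=> z Kz _ ->; exact: is_idealMr.
have [r [w WE]] := hN W hW; rewrite ideal_gen_rangeE in WE.
have [p [g mE]] := hN m hm; rewrite ideal_gen_rangeE in mE.
have hy := is_ideal_principal y; have hKy := is_ideal_add hK hy.
(* The radical of [K + xyA] contains [m], hence so does that of the larger [K + yA]. *)
have [l hl] : exists l, filtered m (ideal_add K (principal y)) setT l.
  apply: (@filtered_radical _ _ _ (codom g)) => //.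
    by rewrite -mE; apply: sub_ideal_addr.
  move=> a /mem_ideal_span; rewrite -mE => /radK [n hn]; exists n.
  move: hn; apply: ideal_add_sub => //; first exact: sub_ideal_addl.
  apply: principal_sub => //; apply: sub_ideal_addr => //.
  by exists x.
(* A generator of [W] multiplies [K + yA] into [K]. *)
have [L hL] : exists L, filtered m K (ideal_add K (ideal_span (codom w))) L.
  apply: filtered_span hl => // a /mem_ideal_span; rewrite -WE => Wa.
  move=> _ [u [_ [Ku [c ->] ->]]]; rewrite mulrDr; apply: is_idealD => //.
    exact: is_idealM.
  by rewrite mulrCA; apply: is_idealM => //; apply: Wa.
rewrite -WE ideal_addC ideal_add_idr // in hL.
have expW n : ideal_exp m n `<=` ideal_add W (principal (x ^+ n)).
  elim: n => [z _|n IH].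
    apply: sub_ideal_addr => //; by exists z; rewrite expr0 mulr1.
  apply: ideal_mul_sub; first exact: is_ideal_add hW (is_ideal_principal _).
  move=> u v mu /IH [v' [_ [Wv' [c ->] ->]]].
  have [b Kub] := hmy u mu.
  exists (u * v' + c * x ^+ n * (u - b * x)), (c * b * x ^+ n.+1); split.
  - apply: (is_idealD hW); apply: (is_idealM _ hW) => //.
    by move=> _ ->.
  - by exists (c * b).
  - by rewrite exprS; ring.
exists L => n; rewrite addnC.
(* The filtration has [L] steps below [W + m^(n+1)] and [n + 1] steps above it. *)
apply: (@filtered_trans _ _ _ (ideal_add W (ideal_exp m n.+1))).
  exact: filtered_add (is_ideal_exp m n.+1) hL.
elim: (n.+1) => {n}[|n IH].
  rewrite (_ : ideal_add _ _ = setT); first exact: filtered0.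
  apply: ideal_eqT; first exact: is_ideal_add hW (is_idealT A).
  exact: sub_ideal_addr.
rewrite -add1n; apply: filtered_trans IH.
rewrite (_ : ideal_add W (ideal_exp m n) =
  ideal_add (ideal_add W (ideal_exp m n.+1)) (principal (x ^+ n))).
  apply: filteredS => [|z mz]; first exact: filtered0.
  by apply: sub_ideal_addr => //; apply: mem_ideal_mul => //; exact: ideal_exp_expr.
have hWn k := is_ideal_add hW (is_ideal_exp m k).
have hWx := is_ideal_add (hWn n.+1) (is_ideal_principal (x ^+ n)).
have WWx : W `<=` ideal_add (ideal_add W (ideal_exp m n.+1)) (principal (x ^+ n)).
  move=> u Wu; apply: sub_ideal_addl; first exact: is_ideal_principal.
  by apply: sub_ideal_addl Wu; exact: is_ideal_exp.
apply/seteqP; split; apply: ideal_add_sub => //.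
- apply: subset_trans (expW n) _; apply: ideal_add_sub => //.
  exact: sub_ideal_addr (hWn n.+1).
- apply: ideal_add_sub => //; first exact: sub_ideal_addl (is_ideal_exp m n).
  by move=> u /ideal_expS_sub; apply: sub_ideal_addr.
- apply: principal_sub => //; apply: sub_ideal_addr => //; exact: ideal_exp_expr.
Qed.

(** Multiplication by [a] maps [A/(K + m^(n+1))] onto the kernel of
    [A/(K + m^(n+2)) -> A/(K + aA + m^(n+2))], so bounds for [K] are partial sums of bounds for
    [K + aA]. *)
Lemma filtered_exp_lift m K a (G : nat -> nat) : is_ideal m -> is_ideal K -> m a ->
  (forall n, filtered m
     (ideal_add (ideal_add K (principal a)) (ideal_exp m n.+1)) setT (G n)) ->
  forall n, filtered m (ideal_add K (ideal_exp m n.+1)) setT (\sum_(k < n.+1) G k).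
Proof.
move=> hm hK ma hG; elim=> [|n IH].
  (* As [a] lies in [m], adjoining it to [K + m] changes nothing. *)
  rewrite big_ord1; have h := hG 0; rewrite ideal_addAC in h.
  rewrite ideal_add_idr // in h; first exact: is_ideal_add hK (is_ideal_exp m 1).
    exact: is_ideal_principal.
  apply: principal_sub; first exact: is_ideal_add hK (is_ideal_exp m 1).
  by apply: sub_ideal_addr => //; rewrite /= ideal_mulT.
rewrite big_ord_recr /=.
apply: (@filtered_trans _ _ _ (ideal_add (ideal_add K (ideal_exp m n.+2)) (principal a))).
  apply: filtered_principal IH.
  - exact: is_ideal_add hK (is_ideal_exp m n.+1).
  - exact: is_ideal_add hK (is_ideal_exp m n.+2).
  - move=> _ [u [v [Ku mv ->]]]; exists (a * u), (a * v).
    by split; [exact: is_idealM|exact: mem_ideal_mul|rewrite mulrDr].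
by rewrite ideal_addAC; exact: hG.
Qed.

(** This is the hockey-stick identity. *)
Lemma sum_bin_diag j n : (\sum_(k < n.+1) 'C(k + j, j) = 'C(n + j.+1, j.+1))%N.
Proof.
elim: n => [|n IH]; first by rewrite big_ord1 !add0n !binn.
by rewrite big_ord_recr /= IH [in RHS]addSn binS addSnnS.
Qed.

(** [filtered_exp_lift] is iterated from [n + 1 + L = C(n+1, 1) + L C(n, 0)]; each summation raises
    both binomials by one index. *)
Lemma filtered_exp_span m K s L : is_ideal m -> is_ideal K ->
  (forall a, a \in s -> m a) ->
  (forall n, filtered m
     (ideal_add (ideal_add K (ideal_span s)) (ideal_exp m n.+1)) setT (n.+1 + L)) ->
  forall n, filtered m (ideal_add K (ideal_exp m n.+1)) setT
    ('C(n + (size s).+1, (size s).+1) + L * 'C(n + size s, size s)).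
Proof.
move=> hm; elim: s K => [|a s IH] K hK sm hf n /=.
  have h0 : ideal_add K (ideal_span [::]) = K.
    apply: ideal_add_idr => // [|_ ->]; first exact: is_ideal_set0.
    exact: is_ideal0.
  by have := hf n; rewrite h0 bin1 addn0 bin0 muln1 addn1.
have ha := is_ideal_principal a.
have -> : ('C(n + (size s).+2, (size s).+2) + L * 'C(n + (size s).+1, (size s).+1) =
  \sum_(k < n.+1) ('C(k + (size s).+1, (size s).+1) + L * 'C(k + size s, size s)))%N.
  by rewrite big_split /= -big_distrr /= !sum_bin_diag.
apply: (@filtered_exp_lift m K a
  (fun k => 'C(k + (size s).+1, (size s).+1) + L * 'C(k + size s, size s))%N) => //.
  exact/sm/mem_head.
apply: IH => [|b bs|k].
- exact: is_ideal_add.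
- by apply: sm; rewrite inE bs orbT.
- by have := hf k; rewrite /= ideal_addA.
Qed.

End LocalRings.

(** * Integral closure *)

Section Integrality.
Variable A : comNzRingType.
Implicit Types (I J K P Q X m : set A) (x y z a : A).

(* The polynomials whose homogenization of degree [k] has coefficients in the
   Rees algebra of [Q]: the coefficient of [X^j] lies in [Q^(k - j)], no
   condition being put for [j >= k]. *)
Definition rees_poly Q k : set {poly A} :=
  [set p | forall j, ideal_exp Q (k - j) p`_j].

Lemma rees_polyD Q k p q : rees_poly Q k p -> rees_poly Q k q -> rees_poly Q k (p + q).
Proof.
by move=> hp hq j; rewrite coefD; apply: is_idealD; [exact: is_ideal_exp|exact: hp|exact: hq].
Qed.

Lemma rees_polyM Q k l p q :
  rees_poly Q k p -> rees_poly Q l q -> rees_poly Q (k + l) (p * q).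
Proof.
move=> hp hq j; rewrite coefM; apply: is_ideal_sum => [|i _].
  exact: is_ideal_exp.
(* Truncated subtraction can only make this exponent larger than [k + l - j]. *)
apply: (@ideal_exp_sub _ _ ((k - i) + (l - (j - i)))); first by have := ltn_ord i; lia.
by apply: ideal_expD.
Qed.

Lemma rees_poly_prod Q n (F : 'I_n -> {poly A}) :
  (forall i, rees_poly Q 1 (F i)) -> rees_poly Q n (\prod_i F i).
Proof.
move=> hF; have rees1 : rees_poly Q 0 1 by move=> j.
elim: n F hF => [|n IH] F hF; first by rewrite big_ord0.
rewrite big_ord_recl; have := @rees_polyM Q 1 n; rewrite add1n; apply=> //.
by apply: IH.
Qed.

(** Entries of [X - M] have degree 1 in the sense of [rees_poly], and signs have degree 0, so each
    term of the determinant has degree [n]. *)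
Lemma rees_char_poly Q n (M : 'M[A]_n) : is_ideal Q ->
  (forall i j, Q (M i j)) -> rees_poly Q n (char_poly M).
Proof.
move=> hQ hM; rewrite /char_poly /determinant.
have rees0 : rees_poly Q n 0.
  by move=> j; rewrite coef0; apply: is_ideal0; exact: is_ideal_exp.
elim/big_ind: _ => //; first by move=> p q; apply: rees_polyD.
move=> s _; have := @rees_polyM Q 0 n; rewrite add0n; apply.
  by move=> j.
apply: rees_poly_prod => i [|j] //.
rewrite !mxE coefB coefMn coefX mul0rn sub0r coefC /= ideal_mulT //.
by rewrite -mulN1r; apply: is_idealM.
Qed.

Lemma integral_closure_monic Q n (p : {poly A}) x : (0 < n)%N ->
  p \is monic -> size p = n.+1 -> rees_poly Q n p -> p.[x] = 0 ->
  integral_closure Q x.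
Proof.
move=> n0 pm sp pQ px; exists n, (fun i => p`_(n - i)); split=> //.
  by move=> i /andP[_ ni]; have := pQ (n - i)%N; rewrite subKn.
rewrite -[RHS]px horner_coef sp big_ord_recr /=.
have -> : p`_n = 1 by have /monicP := pm; rewrite /lead_coef sp.
rewrite mul1r addrC; congr (_ + _).
rewrite big_nat_rev big_add1 /= big_mkord; apply: eq_bigr => i _.
by congr (p`_ _ * x ^+ _); have := ltn_ord i; lia.
Qed.

(** Determinant trick: [x g = M g] with entries of [M] in [Q], so the characteristic polynomial at
    [x] annihilates the ideal generated by [g]. *)
Lemma integral_closure_of_mul Q n (g : 'I_n -> A) x : is_ideal Q ->
  ideal_gen (range g) x ->
  (forall z, ideal_gen (range g) z -> ideal_mul Q (ideal_gen (range g)) (x * z)) ->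
  integral_closure Q x.
Proof.
move=> hQ gx hx.
have /choice[q hq] : forall i, exists q : 'I_n -> A,
    (forall j, Q (q j)) /\ x * g i = \sum_j q j * g j.
  move=> i; have [|q ? ?] := ideal_mul_gen_range hQ (hx (g i) _).
    by apply: sub_ideal_gen; exists i.
  by exists q.
pose M := \matrix_(i, j) q i j.
have detE : (char_poly M).[x] = \det (x%:M - M).
  rewrite -[LHS]/(horner_eval x (\det _)) -det_map_mx; congr (\det _).
  apply/matrixP=> i j; rewrite !mxE /horner_eval.
  by rewrite /= /horner_eval hornerD hornerN hornerMn hornerX hornerC.
have det0 i : (char_poly M).[x] * g i = 0.
  have: (x%:M - M) *m (\col_j g j) = 0.
    apply/matrixP=> k l; rewrite mulmxBl mul_scalar_mx !mxE (hq k).2.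
    by apply/eqP; rewrite subr_eq0; apply/eqP/eq_bigr => j _; rewrite !mxE.
  move/(congr1 (mulmx (\adj (x%:M - M)))); rewrite mulmxA mul_adj_mx mulmx0.
  by rewrite mul_scalar_mx -detE => /matrixP/(_ i 0); rewrite !mxE.
(* Since [x] itself lies in the annihilated ideal, one extra factor ['X] gives a polynomial
   vanishing at [x]; this replaces faithfulness of the module. *)
have px0 : (char_poly M * 'X).[x] = 0.
  rewrite hornerMX mulrC.
  have: ideal_gen (range g) `<=` colon [set 0] [set (char_poly M).[x]].
    apply: ideal_gen_sub; first exact/is_ideal_colon/is_ideal_set0.
    by move=> _ [i _ <-] _ ->; rewrite mulrC /= det0.
  by move=> /(_ x gx); apply.
apply: (@integral_closure_monic Q n.+1 _ x _ _ _ _ px0) => //.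
- by rewrite monicMl ?char_poly_monic ?monicX.
- rewrite size_mulX ?size_char_poly //.
  by rewrite monic_neq0 ?char_poly_monic.
- have := @rees_polyM Q n 1; rewrite addn1; apply.
    by apply: rees_char_poly => // i j; rewrite mxE; exact: (hq i).1.
  move=> [|j] //; rewrite coefX; apply: is_ideal0; exact: is_ideal_exp.
Qed.

End Integrality.

(** As [c ord0] is at least 2, the bounds would give [C(n+d, d) <= (M + L) C(n+d-1, d-1)], but the
    ratio of these binomials is [(n+d)/d]. The factor [(0 < d)] removes the second term for [d = 0],
    where [d.-1] truncates to 0. *)
Lemma bin_sum_growth (d N L : nat) (c : 'I_d.+1 -> int) : 1 < c ord0 ->
  ~ (forall n, (N <= n)%N ->
     \sum_(i < d.+1) (-1) ^+ i * c i * ('C(n + d - i, d - i))%:Z <=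
     ('C(n + d, d) + L * ((0 < d) * 'C(n + d.-1, d.-1)))%N%:Z).
Proof.
move=> c0; case: d c c0 => [|s] c c0 H.
  have := H N (leqnn N).
  by rewrite big_ord1 expr0 mul1r subnn mul0n muln0 addn0 !bin0 mulr1 leNgt c0.
pose M := (\sum_(i < s.+1) `|c (lift ord0 i)|)%N.
(* This [n] makes [n + s + 1] exceed [(s + 1) * (M + L)]. *)
pose n := (N + s.+1 * (M + L))%N.
have := H n (leq_addr _ _); rewrite big_ord_recl expr0 mul1r !subn0 mul1n /=.
set S := \sum_(_ < _) _.
have S_ge : - (M * 'C(n + s, s))%N%:Z <= S.
  rewrite lerNl -sumrN /M big_distrl /= [leRHS](_ : _ =
    \sum_(i < s.+1) (`|c (lift ord0 i)| * 'C(n + s, s))%N%:Z); last first.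
    exact: (big_morph Posz PoszD erefl).
  apply: ler_sum => i _; apply: le_trans (ler_norm _) _.
  rewrite normrN !normrM normrX normrN1 expr1n mul1r PoszM abszE.
  apply: ler_wpM2l => //; rewrite ger0_norm // lez_nat /bump leq0n add1n addnS !subSS.
  have si : (i <= s)%N by rewrite -ltnS.
  (* By symmetry all these binomials get the lower index [n] and are compared through their upper
     index. *)
  have binE a b : 'C(a + b, b) = 'C(a + b, a) by rewrite -[RHS]bin_sub ?leq_addr // addKn.
  by rewrite -addnBA // !binE leq_bin2l // leq_add2l leq_subr.
have := mul_bin_diag (n + s.+1) s; rewrite addnS /= => binE.
have pos : (0 < 'C(n + s, s))%N by rewrite bin_gt0 leq_addl.
set B := 'C((n + s).+1, s.+1) in binE *; set b := 'C(n + s, s) in S_ge binE pos *.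
move=> h.
have {}h : (B <= (M + L) * b)%N.
  have : 2%:Z * B%:Z <= c ord0 * B%:Z by apply: ler_wpM2r.
  nia.
have : ((n + s).+1 * b <= s.+1 * (M + L) * b)%N.
  by rewrite binE -mulnA leq_mul2l h orbT.
rewrite leq_pmul2r // /n; lia.
Qed.

(** * Multiplicity *)

Section Multiplicity.
Variable A : comNzRingType.
Implicit Types (m Q : set A) (d : nat) (e : int).

Lemma has_krull_dim_uniq d d' : has_krull_dim A d -> has_krull_dim A d' -> d = d'.
Proof.
move=> [[P hP] le_d] [[P' hP'] le_d']; apply/eqP.
by rewrite eqn_leq (le_d _ _ hP') (le_d' _ _ hP).
Qed.

(** By [filtered_chain] such filtrations bound the lengths of the [A/m^(n+1)], so the Hilbert
    polynomial would stay below an expression whose coefficient at [C(n+d, d)] is 1. *)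
Lemma multiplicity_growth m d e L : local_with_maximal_ideal m ->
  has_krull_dim A d -> has_multiplicity m e -> 1 < e ->
  ~ (forall n, exists2 k,
      (k <= 'C(n + d, d) + L * ((0 < d) * 'C(n + d.-1, d.-1)))%N &
      filtered m (ideal_exp m n.+1) setT k).
Proof.
move=> hloc hd [d' [c [[hd' [N hN]] <-]]] c1 hf.
move: (has_krull_dim_uniq hd hd') => dd'; subst d'.
apply: (bin_sum_growth c1 (N := N) (L := L)) => n /hN [l [[[J [idJ JS J0 JT]] _] <-]].
have [k kle fk] := hf n; rewrite lez_nat; apply: leq_trans kle.
apply: (filtered_chain _ (is_ideal_exp m n.+1) fk (C := J)) => // [x|i il].
  exact: local_unit.
split=> //; first exact: idJ.
rewrite -J0; elim: i il => [|i IH] il //.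
by apply: subset_trans (IH (ltnW il)) _; case: (JS i il).
Qed.

Lemma mul_colon_parameter_ideal m d Q e : noetherian A ->
  local_with_maximal_ideal m -> has_krull_dim A d -> parameter_ideal m Q ->
  has_multiplicity m e -> 1 < e ->
  ideal_mul m (colon Q m) `<=` ideal_mul m Q.
Proof.
move=> hN hloc hd [d' [a [[hd' _ radQ] QE]]] he e1.
rewrite -QE in radQ; rewrite ideal_gen_rangeE in QE.
have [[hm _ _] _] := hloc.
have Qm : Q `<=` m by move=> z Qz; rewrite -radQ; exists 1; rewrite expr1.
have unit_m c := @local_unit _ m c hloc.
apply: ideal_mul_sub => [|x y mx Iy]; first exact: is_ideal_mul.
have Qxy : Q (x * y) by rewrite mulrC; apply: Iy.
move: (Qxy); rewrite QE => /(ideal_span_exchange unit_m) [//|[s [sz ss sE]]].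
rewrite size_codom card_ord in sz; rewrite -QE in sE.
have [L hL] : exists L, forall n,
    filtered m (ideal_add (ideal_span s) (ideal_exp m n.+1)) setT (n.+1 + L).
  apply: (filtered_almost_principal hN hm (is_ideal_span s) mx (y := y)).
    by rewrite ideal_addC -sE radQ.
  (* As [zy] lies in [Q = xyA + K], it equals some [cxy] modulo [K], the ideal spanned by [s]. *)
  move=> z mz; have := Iy z mz; rewrite sE => -[_ [k [[c ->] hk yz]]].
  by exists c; rewrite mulrBl (mulrC z) yz mulrA addrC addKr.
have add0 K : is_ideal K -> ideal_add [set 0] K = K.
  move=> hK; rewrite ideal_addC ideal_add_idr //; first exact: is_ideal_set0.
  by move=> _ ->; apply: is_ideal0.
(* The dimension is [size s + 1], so lifting the bound from the span of [s] down to the zero ideal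
   gives exactly the growth excluded here. *)
case: (multiplicity_growth (L := L) hloc hd' he e1) => n.
exists ('C(n + (size s).+1, (size s).+1) + L * 'C(n + size s, size s))%N.
  by rewrite sz /= mul1n.
rewrite -[ideal_exp m n.+1]add0; last exact: is_ideal_exp.
apply: (filtered_exp_span (s := s)) => //; first exact: is_ideal_set0.
  by move=> b /ss /mem_ideal_span; rewrite -QE => /Qm.
by move=> k; rewrite add0; [exact: hL|exact: is_ideal_span].
Qed.

(** If [colon Q m] contained a unit, then [m] would lie in [mQ], hence in [m^2] and in every power
    of [m]. All [A/m^(n+1)] would have length at most 1, against [1 < e]. *)
Lemma colon_parameter_ideal_proper m d Q e : noetherian A ->
  local_with_maximal_ideal m -> has_krull_dim A d -> parameter_ideal m Q ->
  has_multiplicity m e -> 1 < e -> colon Q m `<=` m.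
Proof.
move=> hN hloc hd hQ he e1 x Ix; apply: contrapT => mx.
have [d' [a [[_ _ radQ] QE]]] := hQ.
have [[hm _ _] _] := hloc.
have idQ : is_ideal Q by rewrite QE; apply: is_ideal_gen.
have [x' xx'] := local_unit hloc mx.
have IT : colon Q m = setT.
  apply: ideal_eqT; first exact: is_ideal_colon.
  by rewrite -xx'; apply: (is_idealM _ (is_ideal_colon _ idQ)).
have mQ : m `<=` ideal_mul m m.
  have := mul_colon_parameter_ideal hN hloc hd hQ he e1.
  rewrite IT ideal_mulT // => h; apply: subset_trans h _.
  by apply: ideal_mulSS => // z Qz; rewrite -radQ; exists 1; rewrite expr1 -QE.
have mexp n : m `<=` ideal_exp m n.+1.
  elim: n => [|n IH]; first by rewrite /= ideal_mulT.
  by apply: subset_trans mQ _; apply: ideal_mulSS.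
case: (multiplicity_growth (L := 0) hloc hd he e1) => n; exists 1%N.
  by rewrite mul0n addn0 bin_gt0 leq_addl.
by apply: filtered_setT (filtered_maximal hm) => //; exact: is_ideal_exp.
Qed.

End Multiplicity.

(** In the presence of [m] one factor [I] at a time turns into [Q]: [m I^(n+1) = I (m Q^n) = (mI)
    Q^n = m Q^(n+1)]. *)
Lemma ideal_mul_exp_eq (A : comNzRingType) (m I Q : set A) n :
  ideal_mul m I = ideal_mul m Q ->
  ideal_mul m (ideal_exp I n) = ideal_mul m (ideal_exp Q n).
Proof.
move=> mIQ; elim: n => [//|n IH] /=.
by rewrite ideal_mulCA IH ideal_mulA (ideal_mulC I) mIQ -ideal_mulA.
Qed.
Theorem mainTheorem2 (A : comNzRingType) (m : set A) (d : nat) (Q I : set A)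
    (e : int)
    (hnoeth : noetherian A)
    (hlocal : local_with_maximal_ideal m)
    (hdim : has_krull_dim A d)
    (hQ : parameter_ideal m Q)
    (hI : I = colon Q m)
    (he : has_multiplicity m e)
    (he1 : 1 < e) :
  I `<=` integral_closure Q /\
  forall n : int, ideal_mul m (ideal_expz I n) = ideal_mul m (ideal_expz Q n).
Proof.
have mIQ : ideal_mul m I = ideal_mul m Q.
  apply/seteqP; split.
    by rewrite hI; apply: mul_colon_parameter_ideal hnoeth hlocal hdim hQ he he1.
  apply: ideal_mulSS => // x Qx; rewrite hI => y _; apply: is_idealMr => //.
  by have [d' [a [_ ->]]] := hQ; apply: is_ideal_gen.
split; last by case=> [k|k] //=; apply: ideal_mul_exp_eq.
move=> x Ix.
have idQ : is_ideal Q by have [? [? [_ ->]]] := hQ; apply: is_ideal_gen.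
have [[hm _ _] _] := hlocal; have [r [g mE]] := hnoeth m hm.
(* The determinant trick runs on the ideal [m]: [x] lies in it, and [xm] is contained in
   [mI = mQ]. *)
have mx : m x.
  have := colon_parameter_ideal_proper hnoeth hlocal hdim hQ he he1.
  by rewrite -hI; apply.
apply: (integral_closure_of_mul idQ (g := g)); rewrite -mE // => z mz.
by rewrite ideal_mulC -mIQ mulrC; apply: mem_ideal_mul.
Qed.
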